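(* Let $1\le r\le n$. The second order $D_n^r(h^2)$ of $D_n^r$ (the coefficient of $h^2$ in its $h$-expansion) is $$\frac12\binom{n-2}{r-1}H_2+\frac12\binom{n-2}{r-2}H_1^2+\beta\binom{n-1}{r-1}\frac{r(n-1)}{2}H_1+\beta^2\frac{r}{24}\binom{n}{r}\bigl((3r+1)n^2+(1-7r)n+2r\bigr).$$ Here, if $r=1$, the coefficient of $H_1^2$ is regarded as zero.
   Context: Macdonald operators: for $1\le r\le n$, $$D_n^r=t^{r(r-1)/2}\sum_{I\subset\{1,\dots,n\},\,|I|=r}\ \prod_{i\in I,\,j\notin I}\frac{t x_i-x_j}{x_i-x_j}\ \prod_{i\in I}T_{q,x_i},\qquad T_{q,x_i}f(x_1,\dots,x_i,\dots,x_n)=f(x_1,\dots,qx_i,\dots,x_n),$$ acting on symmetric functions (polynomials) in $x_1,\dots,x_n$. Put $q=\exp(h)$, $t=\exp(\beta h)$ with $\beta$ a parameter, so $T_{q,x_i}=\exp(h\,x_i\partial_i)$, $\partial_i=\partial/\partial x_i$, and expand around $h=0$: $D_n^r=\sum_{k\ge0}D_n^r(h^k)\,h^k$. The operator $D_n^r(h^k)$ is called the $k$-th order of $D_n^r$. Dunkl operators: $d_i=x_i\partial_i+\beta\sum_{j\ne i}\frac{x_i}{x_i-x_j}(1-K_{i,j})$, where $K_{i,j}$ exchanges the variables $x_i$ and $x_j$ in a function, and $H_k=\sum_{i=1}^n d_i^k$, regarded as operators on symmetric functions in $x_1,\dots,x_n$. Binomial coefficients have their usual meaning, with $\binom a0=1$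 for every integer $a$ and $\binom ab=0$ for $b<0$. *)

(* Defs.v *)
(* boolp only supplies function extensionality and the eqType and choiceType
   structures of formal power series. *)
From HB Require Import structures.
From mathcomp Require Import all_boot all_order all_fingroup all_algebra.
From mathcomp Require Import generic_quotient boolp.
From mathcomp Require Import ring.
From mathcomp.multinomials Require Import mpoly.

Set Implicit Arguments.
Unset Strict Implicit.
Unset Printing Implicit Defensive.

Import GRing.Theory.
Local Open Scope ring_scope.

(* A[[h]], a formal power series being given by its coefficient sequence. *)
Record fps (A : Type) := Fps { fps_coef : nat -> A }.

Lemma fpsP (A : Type) (u v : fps A) :
  (forall k, fps_coef u k = fps_coef v k) -> u = v.
Proof. by case: u v => [u] [v] /= /funext ->. Qed.

HB.instance Definition _ (A : Type) := gen_eqMixin (fps A).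
HB.instance Definition _ (A : Type) := gen_choiceMixin (fps A).

Section FpsRing.
Variable A : comNzRingType.
Implicit Types u v w : fps A.

Definition fps_const (a : A) : fps A := Fps (fun k => if k is 0 then a else 0).
Definition fps_zero : fps A := Fps (fun=> 0).
Definition fps_opp u : fps A := Fps (fun k => - fps_coef u k).
Definition fps_add u v : fps A := Fps (fun k => fps_coef u k + fps_coef v k).
Definition fps_scale (a : A) u : fps A := Fps (fun k => a * fps_coef u k).
Definition fps_mul u v : fps A :=
  Fps (fun k => \sum_(i < k.+1) fps_coef u i * fps_coef v (k - i)).

Lemma fps_addA : associative fps_add.
Proof. by move=> u v w; apply/fpsP => k /=; rewrite addrA. Qed.
Lemma fps_addC : commutative fps_add.
Proof. by move=> u v; apply/fpsP => k /=; rewrite addrC. Qed.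
Lemma fps_add0 : left_id fps_zero fps_add.
Proof. by move=> u; apply/fpsP => k /=; rewrite add0r. Qed.
Lemma fps_addN : left_inverse fps_zero fps_opp fps_add.
Proof. by move=> u; apply/fpsP => k /=; rewrite addNr. Qed.

HB.instance Definition _ :=
  GRing.isZmodule.Build (fps A) fps_addA fps_addC fps_add0 fps_addN.

Let trunc u N : {poly A} := \poly_(i < N.+1) fps_coef u i.

Let trunc_mul u v k N : (k <= N)%N ->
  (trunc u N * trunc v N)`_k = fps_coef (fps_mul u v) k.
Proof.
move=> kN; rewrite coefM; apply: eq_bigr => i _.
by rewrite !coef_poly !ltnS (leq_trans (leq_subr _ _) kN)
           (leq_trans (leq_ord i) kN).
Qed.

Lemma fps_mulC : commutative fps_mul.
Proof.
by move=> u v; apply/fpsP => k; rewrite -!(trunc_mul _ _ (leqnn k)) mulrC.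
Qed.

Lemma fps_mulA : associative fps_mul.
Proof.
move=> u v w; apply/fpsP => k.
have L : fps_coef (fps_mul (fps_mul u v) w) k =
         (trunc u k * trunc v k * trunc w k)`_k.
  rewrite coefM /=; apply: eq_bigr => i _.
  by rewrite trunc_mul ?leq_ord // coef_poly ltnS leq_subr.
have R : fps_coef (fps_mul u (fps_mul v w)) k =
         (trunc u k * (trunc v k * trunc w k))`_k.
  rewrite coefM /=; apply: eq_bigr => i _.
  by rewrite trunc_mul ?leq_subr // coef_poly ltn_ord.
by rewrite L R mulrA.
Qed.

Lemma fps_const_mul a u : fps_mul (fps_const a) u = fps_scale a u.
Proof.
apply/fpsP => k /=; rewrite big_ord_recl /= subn0 big1 ?addr0 // => i _.
by rewrite mul0r.
Qed.

Lemma fps_mul1 : left_id (fps_const 1) fps_mul.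
Proof. by move=> u; rewrite fps_const_mul; apply/fpsP => k /=; rewrite mul1r. Qed.

Lemma fps_mulDl : left_distributive fps_mul fps_add.
Proof.
move=> u v w; apply/fpsP => k /=; rewrite -big_split /=.
by apply: eq_bigr => i _; rewrite mulrDl.
Qed.

Lemma fps_one_neq0 : fps_const 1 != 0.
Proof. by apply/eqP => /(congr1 (fun u => fps_coef u 0))/eqP; rewrite oner_eq0. Qed.

HB.instance Definition _ := GRing.Zmodule_isComNzRing.Build (fps A)
  fps_mulA fps_mulC fps_mul1 fps_mulDl fps_one_neq0.

Lemma fps_scaleA a b u : fps_scale a (fps_scale b u) = fps_scale (a * b) u.
Proof. by apply/fpsP => k /=; rewrite mulrA. Qed.
Lemma fps_scale1 : left_id 1 fps_scale.
Proof. by move=> u; apply/fpsP => k /=; rewrite mul1r. Qed.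
Lemma fps_scaleDr : right_distributive fps_scale +%R.
Proof. by move=> a u v; apply/fpsP => k /=; rewrite mulrDr. Qed.
Lemma fps_scaleDl u : {morph fps_scale^~ u : a b / a + b}.
Proof. by move=> a b; apply/fpsP => k /=; rewrite mulrDl. Qed.

HB.instance Definition _ := GRing.Zmodule_isLmodule.Build A (fps A)
  fps_scaleA fps_scale1 fps_scaleDr fps_scaleDl.

Lemma fps_scaleAl (a : A) (u v : fps A) : a *: (u * v) = a *: u * v.
Proof.
by rewrite -[LHS]/(fps_scale a (fps_mul u v)) -[RHS]/(fps_mul (fps_scale a u) v)
           -!fps_const_mul fps_mulA.
Qed.

HB.instance Definition _ := GRing.Lmodule_isLalgebra.Build A (fps A) fps_scaleAl.
HB.instance Definition _ := GRing.Lalgebra_isComAlgebra.Build A (fps A).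

End FpsRing.

(* The series exp(a h); it is the exponential only in characteristic zero. *)
Definition fps_exp (A : fieldType) (a : A) : fps A :=
  Fps (fun k => a ^+ k / (k`!)%:R).

Notation ratfun K n := {fraction {mpoly K[n]}}.

Section RationalFunctions.
Variables (K : fieldType) (n : nat).
Local Notation Kx := (ratfun K n).

Definition polyfun (p : {mpoly K[n]}) : Kx := tofrac p.
Definition cstfun (c : K) : Kx := polyfun c%:MP.
Definition var (i : 'I_n) : Kx := polyfun 'X_i.

(* These two are defined on the chosen representative of a fraction; rderiv_div
   and exch_div say that the choice does not matter. *)
Definition rderiv (i : 'I_n) (u : Kx) : Kx :=
  let p := \n_(repr u) in let s := \d_(repr u) in
  polyfun (mderiv i p * s - p * mderiv i s) / polyfun (s ^+ 2).

Definition exch (i j : 'I_n) (u : Kx) : Kx :=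
  polyfun (msym (tperm i j) \n_(repr u)) / polyfun (msym (tperm i j) \d_(repr u)).

Lemma ratfunE (u : Kx) : u = polyfun \n_(repr u) / polyfun \d_(repr u).
Proof.
rewrite /polyfun -{1}[u]reprK; move: (repr u) => x.
have d0 : \d_x != 0 by apply: denom_ratioP.
unlock FracField.tofrac; rewrite -[X in _ * X]FracField.pi_inv -[RHS]FracField.pi_mul.
rewrite /FracField.mulf /FracField.invf /= !numden_Ratio ?oner_eq0 //.
by rewrite mul1r mulr1 Ratio_numden.
Qed.

Lemma repr_div (p s : {mpoly K[n]}) : s != 0 ->
  let u := repr (polyfun p / polyfun s) in
  \d_u != 0 /\ p * \d_u = \n_u * s.
Proof.
move=> s0 u; have d0 : \d_u != 0 by apply: denom_ratioP.
split=> //; apply/eqP; rewrite -tofrac_eq !tofracM.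
by have /eqP := ratfunE (polyfun p / polyfun s); rewrite eqr_div ?tofrac_eq0.
Qed.

Lemma rderiv_div i (p s : {mpoly K[n]}) : s != 0 ->
  rderiv i (polyfun p / polyfun s) =
    polyfun (mderiv i p * s - p * mderiv i s) / polyfun (s ^+ 2).
Proof.
move=> s0; have [] := repr_div p s0; rewrite /rderiv.
set a := \n_ _; set b := \d_ _ => b0 E.
apply/eqP; rewrite eqr_div ?tofrac_eq0 ?expf_neq0 //.
rewrite -!tofracM tofrac_eq -subr_eq0.
have := congr1 (mderiv i) E; rewrite !mderivM => E'.
apply/eqP; transitivity
  (- (b * s * ((mderiv i p * b + p * mderiv i b)
               - (mderiv i a * s + a * mderiv i s)))
   + (b * mderiv i s + s * mderiv i b) * (p * b - a * s)); first by ring.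
by rewrite E' E !subrr !mulr0 oppr0 addr0.
Qed.

Lemma exch_div i j (p s : {mpoly K[n]}) : s != 0 ->
  exch i j (polyfun p / polyfun s) =
    polyfun (msym (tperm i j) p) / polyfun (msym (tperm i j) s).
Proof.
move=> s0; have [] := repr_div p s0; rewrite /exch.
set a := \n_ _; set b := \d_ _ => b0 E.
have m0 (c : {mpoly K[n]}) : c != 0 -> msym (tperm i j) c != 0.
  by rewrite -(inj_eq (@inj_msym n K (tperm i j))) msym0.
apply/eqP; rewrite eqr_div ?tofrac_eq0 ?m0 // -!tofracM tofrac_eq.
by rewrite -!msymM -E mulrC.
Qed.

Variable beta : K.

(* Operators on all rational functions; they preserve K[x]. *)
Definition dunkl (i : 'I_n) (u : Kx) : Kx :=
  var i * rderiv i u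
  + cstfun beta * \sum_(j | j != i) var i / (var i - var j) * (u - exch i j u).

Definition dunklH (k : nat) (u : Kx) : Kx := \sum_i iter k (dunkl i) u.

End RationalFunctions.

Section Macdonald.
Variables (K : fieldType) (n : nat).

Definition qshift (S : comNzRingType) (q : S) (i : 'I_n) (p : {mpoly S[n]}) :
    {mpoly S[n]} :=
  p \mPo [tuple if j == i then q *: 'X_j else 'X_j | j < n].

(* D_n^r f at parameters q and t in a commutative K(x)-algebra S: the shifts act
   on S[x], and the shifted polynomial is then evaluated at the variables, as
   the rational coefficients of the operator lie in K(x). *)
Definition macdonald (S : comAlgType (ratfun K n)) (q t : S) (r : nat)
    (f : {mpoly K[n]}) : S :=
  let X (i : 'I_n) : S := (var K i)%:A in
  let fS : {mpoly S[n]} := map_mpoly (fun c => (cstfun n c)%:A) f in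
  t ^+ (r * (r - 1))./2 *
  \sum_(I : {set 'I_n} | #|I| == r)
    (\prod_(i in I) \prod_(j in ~: I)
       ((var K i - var K j)^-1 *: (t * X i - X j))) *
    ((\big[comp/idfun]_(i in I) qshift q i) fS).@[X].

(* D_n^r(h^k): the coefficient of h^k for q = exp(h), t = exp(beta h). *)
Definition macdonald_order (beta : K) (k r : nat) (f : {mpoly K[n]}) :
    ratfun K n :=
  fps_coef (macdonald (fps_exp 1) (fps_exp (cstfun n beta)) r f) k.

End Macdonald.

(* Integer binomial coefficient; a = - (m + 1) in the branch Negz m. *)
Definition binz (a b : int) : int :=
  match a, b with
  | Posz m, Posz k => 'C(m, k)%:Z
  | Negz m, Posz k => (-1) ^+ k * 'C(m + k, k)%:Z
  | _, Negz _ => 0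
  end.

(* Main.v *)
(* Write D_i = x_i d/dx_i, y_ij = x_i / (x_i - x_j) and w_i = sum_(j != i) y_ij.
   Since y_ij + y_ji = 1, the sum of y_ij over distinct i, j in an r-set I is
   r(r-1)/2, so the weight t^(r(r-1)/2) prod (t x_i - x_j) / (x_i - x_j) attached
   to I has h-coefficient beta sum_(i in I) w_i; its logarithm has h^2-coefficient
   (beta^2 / 2) sum_(i in I, j notin I) y_ij y_ji. The shifts act as
   exp(h sum_(i in I) D_i), so the h^2-coefficient of D_n^r is a sum over I of
   expressions that are at most quadratic in I. Summing over I only involves the
   numbers e1, e2 of r-sets containing one, resp. two given points, and the
   constant term is evaluated with
   sum_i w_i^2 + sum_(i,j) y_ij y_ji = n(n-1)(2n-1)/6. *)
Require Import Defs.
From HB Require Import structures.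
From mathcomp Require Import all_boot all_order all_fingroup all_algebra ring.
From mathcomp.multinomials Require Import mpoly.

Set Implicit Arguments.
Unset Strict Implicit.
Unset Printing Implicit Defensive.

Import GRing.Theory.
Local Open Scope ring_scope.

(** * Counting r-subsets that contain given points *)

(** The guard matters: for [a > r] truncated subtraction would give ['C(n - a, 0)], that is 1
    instead of 0. *)
Definition draws_over (n r a : nat) : nat :=
  if (a <= r)%N then 'C(n - a, r - a) else 0.

(** Adjoining [A] is a bijection from the subsets of size [r - #|A|] of its complement onto these
    sets; removing [A] inverts it. *)
Lemma card_draws_over (T : finType) (A : {set T}) (r : nat) :
  #|[set I : {set T} | A \subset I & #|I| == r]| = draws_over #|T| r #|A|.
Proof.
rewrite /draws_over; case: ifP => [Ar | /negbT]; last first.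
  rewrite -ltnNge => rA; apply: eq_card0 => I; rewrite !inE.
  by apply/negP => /andP[/subset_leq_card AI /eqP Ir]; rewrite -Ir ltnNge AI in rA.
rewrite -(cardsC A) addKn -cards_draws.
have dAB (B : {set T}) : B \subset ~: A -> (A :|: B) :\: A = B.
  move=> /subsetP BA; apply/setP => x; rewrite !inE.
  by case xA: (x \in A); case xB: (x \in B); move: (BA x); rewrite ?inE xA xB //= => /(_ isT).
rewrite -[RHS](card_in_imset (f := fun B => A :|: B)); last first.
  move=> B C; rewrite !inE => /andP[BA _] /andP[CA _] E.
  by rewrite -(dAB B BA) E dAB.
apply: eq_card => I; apply/idP/imsetP => [|[B]]; rewrite !inE.
  move=> /andP[AI /eqP Ir]; exists (I :\: A); last first.
    by rewrite -{1}(setIidPr AI) setID.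
  by rewrite inE setDE subsetIr -setDE cardsD (setIidPr AI) Ir eqxx.
move=> /andP[BA /eqP cB] ->; rewrite subsetUl cardsU.
have /eqP -> : A :&: B == set0 by rewrite setI_eq0 disjoint_sym disjoints_subset.
by rewrite cards0 subn0 cB subnKC ?eqxx.
Qed.

Lemma draws_over1 (n r : nat) : (0 < r)%N -> (n * draws_over n r 1 = r * 'C(n, r))%N.
Proof.
by case: n r => [|n] [|r] // _; rewrite /draws_over /= !subn1 /= mul_bin_diag.
Qed.

(** With [draws_over1], this expresses the two counts through ['C(n, r)]. At [r = 1] both sides
    vanish, the left one by the guard. *)
Lemma draws_over2 (n r : nat) : (0 < r)%N ->
  (n.-1 * draws_over n r 2 = r.-1 * draws_over n r 1)%N.
Proof.
case: r => [|[|r]] // _; first by rewrite /draws_over /= muln0.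
case: n => [|[|n]]; rewrite /draws_over /= ?subn1 ?muln0 //=.
by rewrite !subn2 /= mul_bin_diag.
Qed.

(** * Sums over r-subsets of linear and quadratic expressions *)

Section SubsetSums.
Variables (R : comNzRingType) (n r : nat).
Local Notation e a := ((draws_over n r a)%:R : R).

Lemma sum_draws (F : 'I_n -> R) :
  \sum_(I : {set 'I_n} | #|I| == r) \sum_(i in I) F i = e 1 * \sum_i F i.
Proof.
rewrite (exchange_big_dep xpredT) //= mulr_sumr; apply: eq_bigr => i _.
rewrite sumr_const mulr_natl -(cards1 i).
have := card_draws_over [set i] r; rewrite card_ord => <-.
by congr (_ *+ _); apply: eq_card => I; rewrite !inE sub1set andbC.
Qed.

(** The number of r-sets containing both i and j is e1 on the diagonal and e2 off it, so [F i j] has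
    coefficient (e1 - e2) [i = j] + e2. *)
Lemma sum_draws2 (F : 'I_n -> 'I_n -> R) :
  \sum_(I : {set 'I_n} | #|I| == r) \sum_(i in I) \sum_(j in I) F i j =
  (e 1 - e 2) * \sum_i F i i + e 2 * \sum_i \sum_j F i j.
Proof.
transitivity (\sum_i \sum_j ((i == j)%:R * (e 1 - e 2) + e 2) * F i j).
  rewrite (exchange_big_dep xpredT) //=; apply: eq_bigr => i _.
  rewrite (exchange_big_dep xpredT) //=; apply: eq_bigr => j _.
  rewrite sumr_const -[LHS]mulr_natl; congr (_ * _).
  transitivity ((draws_over n r #|[set i; j]|)%:R : R); last first.
    by rewrite cards2; case: eqP => _ /=; [rewrite mul1r subrK | rewrite mul0r add0r].
  have := card_draws_over [set i; j] r; rewrite card_ord => <-.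
  congr _%:R; apply: eq_card => I.
  by rewrite !inE subUset !sub1set [RHS]andbC [LHS]unfold_in -andbA.
rewrite !mulr_sumr -big_split /=; apply: eq_bigr => i _.
rewrite mulr_sumr; under eq_bigr do rewrite mulrDl; rewrite big_split /=.
congr (_ + _); rewrite (bigD1 i) //= eqxx mul1r big1 ?addr0 // => j ji.
by rewrite eq_sym (negPf ji) !mul0r.
Qed.

End SubsetSums.

(** * Identities for the weights x_i / (x_i - x_j) *)

Section DunklWeights.
Variables (F : fieldType) (n : nat) (x : 'I_n -> F).
Hypothesis x_inj : injective x.

(* [wt i i] is 0, since division by zero gives 0. *)
Definition wt (i j : 'I_n) : F := x i / (x i - x j).
Definition wtsum (i : 'I_n) : F := \sum_j wt i j.

Lemma wtii i : wt i i = 0. Proof. by rewrite /wt subrr invr0 mulr0. Qed.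

Lemma subx_neq0 i j : i != j -> x i - x j != 0.
Proof. by rewrite subr_eq0 (inj_eq x_inj). Qed.

Lemma wtD i j : wt i j + wt j i = 1 - (i == j)%:R.
Proof.
have [<-|ij] := eqVneq i j; first by rewrite wtii subrr addr0.
have ? := subx_neq0 ij; have ? : x j - x i != 0 by rewrite subx_neq0 // eq_sym.
by rewrite /wt /=; field; apply/andP.
Qed.

Lemma wtM i j : wt i j * wt j i = wt i j - wt i j ^+ 2.
Proof.
have [<-|ij] := eqVneq i j; first by rewrite wtii expr0n mulr0 subrr.
have /(canRL (addKr _)) -> : wt i j + wt j i = 1.
  by rewrite wtD (negPf ij) subr0.
by ring.
Qed.

(** For distinct indices the right side is just 1. The delta terms correct the degenerate cases, so
    that the identity can be summed over all triples. *)
Lemma wt_triple i j l :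
  wt i j * wt i l + wt j l * wt j i + wt l i * wt l j =
  1 - (i == j)%:R - (j == l)%:R - (i == l)%:R + 2 * ((i == j)%:R * (j == l)%:R)
  + (j == l)%:R * wt i j ^+ 2 + (l == i)%:R * wt j l ^+ 2
  + (i == j)%:R * wt l i ^+ 2.
Proof.
have [->|ij] := eqVneq i j; have [<-|jl] := eqVneq j l; rewrite ?eqxx ?wtii //=.
- by ring.
- by ring.
- by rewrite (negPf ij) eq_sym (negPf ij) /=; ring.
have [<-|il] := eqVneq i l; first by rewrite !wtii /=; ring.
have ? := subx_neq0 ij; have ? := subx_neq0 jl; have ? := subx_neq0 il.
have ? : x j - x i != 0 by rewrite subx_neq0 // eq_sym.
have ? : x l - x i != 0 by rewrite subx_neq0 // eq_sym.
have ? : x l - x j != 0 by rewrite subx_neq0 // eq_sym.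
by rewrite /wt /=; field; repeat (apply/andP; split).
Qed.

Lemma sum_delta (G : 'I_n -> F) i : \sum_j (i == j)%:R * G j = G i.
Proof.
rewrite (bigD1 i) //= eqxx mul1r big1 ?addr0 // => j ji.
by rewrite eq_sym (negPf ji) mul0r.
Qed.

Lemma sum_deltac (c : F) (i : 'I_n) : \sum_j (i == j)%:R * c = c.
Proof. exact: (sum_delta (fun=> c)). Qed.

Lemma sum_wt2 (A : {set 'I_n}) :
  2 * \sum_(i in A) \sum_(j in A) wt i j = #|A|%:R * (#|A|%:R - 1).
Proof.
rewrite mulr_natl mulr2n {2}exchange_big -big_split /=.
transitivity (\sum_(i in A) \sum_(j in A) (1 - (i == j)%:R : F)).
  by apply: eq_bigr => i _; rewrite -big_split; apply: eq_bigr => j _; rewrite /= wtD.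
transitivity (\sum_(i in A) (#|A|%:R - 1 : F)); last by rewrite sumr_const mulr_natl.
apply: eq_bigr => i iA; rewrite sumrB sumr_const (bigD1 i) //= eqxx big1 ?addr0 //.
by move=> j /andP[_ ji]; rewrite eq_sym (negPf ji).
Qed.

Lemma sum_wtsum : 2 * \sum_i wtsum i = n%:R * (n%:R - 1).
Proof.
have := sum_wt2 [set: 'I_n]; rewrite cardsT card_ord => <-; congr (_ * _).
by apply: eq_big => [i|i _]; rewrite ?inE //; apply: eq_bigl => j; rewrite inE.
Qed.

(** Expanding the squares gives a sum over triples. Averaging it over cyclic rotations brings in
    [wt_triple]; only the sum of the squared weights survives unevaluated. *)
Lemma sum_wtsum_sqr :
  3 * \sum_i wtsum i ^+ 2 =
  n%:R * (n%:R - 1) * (n%:R - 2) + 3 * \sum_i \sum_j wt i j ^+ 2.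
Proof.
have cyc (G : 'I_n -> 'I_n -> 'I_n -> F) :
    \sum_i \sum_j \sum_l G j l i = \sum_i \sum_j \sum_l G i j l.
  by rewrite exchange_big /=; apply: eq_bigr => j _; rewrite exchange_big.
have Ew : \sum_i wtsum i ^+ 2 = \sum_i \sum_j \sum_l wt i j * wt i l.
  apply: eq_bigr => i _; rewrite expr2 mulr_suml; apply: eq_bigr => j _.
  by rewrite -mulr_sumr.
have -> : 3 * \sum_i wtsum i ^+ 2 = \sum_i \sum_j \sum_l
    (wt i j * wt i l + wt j l * wt j i + wt l i * wt l j).
  transitivity (\sum_i \sum_j \sum_l wt i j * wt i l
    + \sum_i \sum_j \sum_l wt j l * wt j i + \sum_i \sum_j \sum_l wt l i * wt l j).
    rewrite (cyc (fun i j l => wt i j * wt i l)).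
    by rewrite -(cyc (fun i j l => wt l i * wt l j)) -Ew; ring.
  rewrite -!big_split; apply: eq_bigr => i _; rewrite -!big_split.
  by apply: eq_bigr => j _; rewrite -!big_split.
transitivity (\sum_i \sum_j
  (n%:R - 2 + (2 - n%:R) * (i == j)%:R + wt i j ^+ 2 + wt j i ^+ 2
   + (i == j)%:R * \sum_l wt l i ^+ 2)).
  apply: eq_bigr => i _; apply: eq_bigr => j _.
  transitivity (\sum_l ((1 - (i == j)%:R) + (j == l)%:R * (2 * (i == j)%:R - 1 + wt i j ^+ 2)
      + (i == l)%:R * (wt j l ^+ 2 - 1) + (i == j)%:R * wt l i ^+ 2)).
    by apply: eq_bigr => l _; rewrite wt_triple (eq_sym l i); ring.
  rewrite !big_split /= -mulr_sumr !sum_delta !sumr_const !card_ord.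
  by ring.
transitivity (\sum_i (n%:R * (n%:R - 2) + (2 - n%:R)
    + \sum_j wt i j ^+ 2 + \sum_j wt j i ^+ 2 + \sum_l wt l i ^+ 2)).
  apply: eq_bigr => i _; rewrite !big_split /= !sumr_const !card_ord -mulr_sumr.
  rewrite sum_delta.
  have -> : \sum_j (i == j)%:R = 1 :> F.
    by rewrite -[RHS](sum_deltac 1 i); under [RHS]eq_bigr do rewrite mulr1.
  by ring.
rewrite !big_split /= !sumr_const card_ord.
rewrite [\sum_(i < n) \sum_(j < n) wt j i ^+ 2]exchange_big /=.
by ring.
Qed.

(** By [wtM] the products y_ij y_ji contribute minus the sum of squared weights, which cancels the
    part that [sum_wtsum_sqr] leaves open. *)
Lemma sum_wt_sqr :
  6 * (\sum_i wtsum i ^+ 2 + \sum_i \sum_j wt i j * wt j i) =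
  n%:R * (n%:R - 1) * (2 * n%:R - 1).
Proof.
have -> : \sum_i \sum_j wt i j * wt j i = \sum_i wtsum i - \sum_i \sum_j wt i j ^+ 2.
  rewrite -sumrB; apply: eq_bigr => i _; rewrite -sumrB.
  by apply: eq_bigr => j _; rewrite wtM.
transitivity (2 * (3 * \sum_i wtsum i ^+ 2) + 3 * (2 * \sum_i wtsum i)
  - 6 * \sum_i \sum_j wt i j ^+ 2); first by ring.
by rewrite sum_wtsum_sqr sum_wtsum; ring.
Qed.
End DunklWeights.

(** * Low-order coefficients of products of power series *)

Section PowerSeries.
Variable A : comNzRingType.
Implicit Types u v : fps A.

Lemma fps_coefZ (a : A) u k : fps_coef (a *: u) k = a * fps_coef u k.
Proof. by []. Qed.

Lemma fps_coefB u v k : fps_coef (u - v) k = fps_coef u k - fps_coef v k.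
Proof. by []. Qed.

Lemma fps_coefM u v k :
  fps_coef (u * v) k = \sum_(i < k.+1) fps_coef u i * fps_coef v (k - i).
Proof. by []. Qed.

Lemma fps_coefM2 u v : fps_coef (u * v) 2 =
  fps_coef u 0 * fps_coef v 2 + fps_coef u 1 * fps_coef v 1
  + fps_coef u 2 * fps_coef v 0.
Proof. by rewrite fps_coefM !big_ord_recr big_ord0 /= add0r. Qed.

Lemma fps_coef1 k : fps_coef (1 : fps A) k = (k == 0)%:R.
Proof. by case: k. Qed.

Lemma fps_coef_sum (I : Type) (s : seq I) (P : pred I) (G : I -> fps A) k :
  fps_coef (\sum_(i <- s | P i) G i) k = \sum_(i <- s | P i) fps_coef (G i) k.
Proof. by elim/big_rec2: _ => [//|i a b _ <-]. Qed.

(* [logcoef2 u] is twice the coefficient of h^2 in log u when u has constant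
   coefficient 1. *)
Definition logcoef2 u := 2 * fps_coef u 2 - fps_coef u 1 ^+ 2.

(** The logarithm turns products into sums. Working with [logcoef2] avoids the cross terms in the
    h^2-coefficient itself. *)
Lemma fps_prod_low (I : Type) (s : seq I) (P : pred I) (G : I -> fps A) :
  (forall i, P i -> fps_coef (G i) 0 = 1) ->
  [/\ fps_coef (\prod_(i <- s | P i) G i) 0 = 1,
      fps_coef (\prod_(i <- s | P i) G i) 1 = \sum_(i <- s | P i) fps_coef (G i) 1
    & logcoef2 (\prod_(i <- s | P i) G i) = \sum_(i <- s | P i) logcoef2 (G i)].
Proof.
move=> G0; elim/big_ind3: _ => [|u a b v c d [u0 u1 u2] [v0 v1 v2]|i Pi].
- by rewrite /logcoef2 !fps_coef1; split; rewrite //=; ring.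
- rewrite -u1 -u2 -v1 -v2 /logcoef2 !fps_coefM !big_ord_recr !big_ord0 /= u0 v0.
  by split; ring.
by split; rewrite ?G0.
Qed.

End PowerSeries.

(** * The exponential series in characteristic zero *)

Section Exponential.
Variable F : fieldType.
Hypothesis charF : [pchar F] =i pred0.

Lemma natrS_neq0 k : (k.+1)%:R != 0 :> F.
Proof. by rewrite ((pcharf0P _).1 charF). Qed.

Lemma factf_neq0 k : k`!%:R != 0 :> F.
Proof. by rewrite ((pcharf0P _).1 charF) -lt0n fact_gt0. Qed.

Lemma fps_exp0 : fps_exp (0 : F) = 1.
Proof.
by apply/fpsP => -[|k]; rewrite fps_coef1 /= ?expr0 ?divr1 // expr0n mul0r.
Qed.

Lemma fps_expD (a b : F) : fps_exp (a + b) = fps_exp a * fps_exp b.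
Proof.
apply/fpsP => k; rewrite fps_coefM /= addrC exprDn mulr_suml.
apply: eq_bigr => i _; have ik : (i <= k)%N by rewrite -ltnS.
rewrite -(bin_fact ik) 2!natrM -mulr_natr.
have Ci : 'C(k, i)%:R != 0 :> F by rewrite ((pcharf0P _).1 charF) -lt0n bin_gt0.
by field; rewrite Ci !factf_neq0.
Qed.

Lemma fps_expX (a : F) N : fps_exp a ^+ N = fps_exp (N%:R * a).
Proof.
elim: N => [|N IHN]; first by rewrite expr0 mul0r fps_exp0.
by rewrite exprS IHN -fps_expD; congr fps_exp; ring.
Qed.

End Exponential.

(** * Euler operators x_i d/dx_i on polynomials *)

Section Polynomials.
Variables (K : fieldType) (n : nat).
Implicit Types (p : {mpoly K[n]}) (i j : 'I_n) (I : {set 'I_n}).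
Local Notation Kx := (ratfun K n).
Local Notation pf := (@polyfun K n).

HB.instance Definition _ := GRing.RMorphism.copy pf (@FracField.tofrac {mpoly K[n]}).
HB.instance Definition _ :=
  GRing.RMorphism.copy (@cstfun K n) (pf \o (@mpolyC n K)).

Lemma polyfun_inj : injective pf.
Proof. by move=> p q /eqP; rewrite /polyfun tofrac_eq => /eqP. Qed.

Lemma var_inj : injective (@var K n).
Proof.
move=> i j /polyfun_inj /(congr1 (fun p => p@_U_(j))); rewrite !mcoeffXU eqxx.
by case: eqP => // _ /eqP; rewrite eq_sym oner_eq0.
Qed.

Lemma pchar_ratfun : [pchar K] =i pred0 -> [pchar Kx] =i pred0.
Proof. by move=> charK p; rewrite -charK (fmorph_pchar (@cstfun K n)). Qed.

Definition euler i p : {mpoly K[n]} := 'X_i * mderiv i p.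

Definition eulers I p : {mpoly K[n]} := \sum_(i in I) euler i p.

Lemma euler_is_linear i : linear (euler i).
Proof. by move=> c p q; rewrite /euler mderivD mderivZ mulrDr -scalerAr. Qed.

HB.instance Definition _ i :=
  GRing.isLinear.Build K {mpoly K[n]} {mpoly K[n]} _ (euler i) (euler_is_linear i).

Lemma eulerX i m : euler i 'X_[m] = (m i)%:R *: 'X_[m].
Proof.
(* If x_i does not occur, lowering its exponent truncates and cannot be undone, but the scalar is
   0. *)
rewrite /euler mderivX -scalerAr; have [->|mi] := eqVneq (m i) 0%N.
  by rewrite !scale0r.
by rewrite -mpolyXD addmC submK // lep1mP.
Qed.

Lemma mcoeff_euler i p m : (euler i p)@_m = (m i)%:R * p@_m.
Proof.
rewrite (mpolyE p) !raddf_sum /= mulr_sumr; apply: eq_bigr => m' _.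
rewrite linearZ /= eulerX !mcoeffZ mcoeffX.
by case: eqP => [->|_]; [rewrite mulrCA | rewrite !mulr0].
Qed.

Lemma mcoeff_eulers I p m : (eulers I p)@_m = (\sum_(i in I) m i)%:R * p@_m.
Proof.
rewrite /eulers raddf_sum natr_sum mulr_suml.
by apply: eq_bigr => i _; exact: mcoeff_euler.
Qed.

Lemma msym_euler i j l p :
  msym (tperm i j) (euler l p) = euler (tperm i j l) (msym (tperm i j) p).
Proof.
apply/mpolyP => m; rewrite mcoeff_sym !mcoeff_euler mcoeff_sym mnmE.
by [].
Qed.

Lemma rderiv_polyfun i p : rderiv i (pf p) = pf (mderiv i p).
Proof.
have := rderiv_div i p (oner_neq0 _); rewrite !rmorph1 divr1 => ->.
by rewrite expr1n rmorph1 divr1 mulr1 mderivC mulr0 subr0.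
Qed.

Lemma exch_polyfun i j p : exch i j (pf p) = pf (msym (tperm i j) p).
Proof.
by have := exch_div i j p (oner_neq0 _); rewrite !rmorph1 !divr1.
Qed.

(** Every monomial is an eigenvector of [eulers I], with eigenvalue its degree in the variables of
    [I]. *)
Lemma iter_eulers k I p :
  pf (iter k (eulers I) p) = \sum_(m <- msupp p)
    cstfun n p@_m * pf 'X_[m] * (\sum_(i in I) m i)%:R ^+ k.
Proof.
have -> : iter k (eulers I) p = \sum_(m <- msupp p)
    ((\sum_(i in I) m i)%:R ^+ k * p@_m) *: 'X_[m].
  apply/mpolyP => m; rewrite [RHS]raddf_sum /=.
  under eq_bigr do rewrite mcoeffZ -mulrA -[p@__ * _]mcoeffZ.
  transitivity ((\sum_(i in I) m i)%:R ^+ k * p@_m).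
    by elim: k => [|k IHk]; rewrite ?mul1r //= mcoeff_eulers IHk exprS mulrA.
  rewrite {1}(mpolyE p) [(\sum_(_ <- _) _)@_m]raddf_sum /= mulr_sumr.
  apply: eq_bigr => m' _; rewrite !mcoeffZ mcoeffX.
  by case: eqP => [->//|_]; rewrite !mulr0.
rewrite rmorph_sum; apply: eq_bigr => m _.
by rewrite -mul_mpolyC !rmorphM /= !rmorphXn !rmorph_nat /cstfun; ring.
Qed.

End Polynomials.

(** * The q-shifts and their expansion in h *)

Section Shifts.
Variables (n : nat) (S : comNzRingType) (q : S).
Implicit Types (i : 'I_n) (m : 'X_{1..n}) (I : {set 'I_n}).

Lemma qshiftX i (c : S) m :
  qshift q i (c *: 'X_[m]) = (c * q ^+ m i) *: 'X_[m].
Proof.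
rewrite /qshift comp_mpolyZ -scalerA; congr (_ *: _).
rewrite comp_mpolyX [X in _ = _ *: X]mpolyXE_id -mul_mpolyC.
rewrite (bigD1 i) //= [in RHS](bigD1 i) //= tnth_mktuple eqxx exprZn -mul_mpolyC mulrA.
congr (_ * _); apply: eq_bigr => j ji.
by rewrite tnth_mktuple (negPf ji).
Qed.

Lemma qshiftsX I (c : S) m :
  (\big[comp/idfun]_(i in I) qshift q i) (c *: 'X_[m]) =
  (c * q ^+ (\sum_(i in I) m i)) *: 'X_[m].
Proof.
(* The scalar is quantified inside [T] because each further shift changes it. *)
pose T (G : {mpoly S[n]} -> {mpoly S[n]}) N :=
  forall c, G (c *: 'X_[m]) = (c * q ^+ N) *: 'X_[m].
suff: T (\big[comp/idfun]_(i in I) qshift q i) (\sum_(i in I) m i)%N by exact.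
elim/big_rec2: _ => [|i N G _ IH] b /=; first by rewrite expr0 mulr1.
by rewrite IH qshiftX -mulrA -exprD addnC.
Qed.

Lemma qshiftsD I :
  {morph (\big[comp/idfun]_(i in I) qshift q i) : p p' / p + p'}.
Proof.
elim/big_rec: _ => // i G _ IH p p' /=.
by rewrite IH /qshift comp_mpolyD.
Qed.

Lemma qshifts_sum I (U : Type) (s : seq U) (G : U -> {mpoly S[n]}) :
  (\big[comp/idfun]_(i in I) qshift q i) (\sum_(u <- s) G u) =
  \sum_(u <- s) (\big[comp/idfun]_(i in I) qshift q i) (G u).
Proof.
elim: s => [|u s IHs]; last by rewrite !big_cons qshiftsD IHs.
(* The shifts fix 0, seen as 0 times the constant monomial. *)
by rewrite !big_nil; have := qshiftsX I 0 0%MM; rewrite mul0r !scale0r.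
Qed.

End Shifts.

(** A monomial of degree d in the variables of [I] is multiplied by exp(h)^d = exp(d h), whose
    coefficient d^k / k! matches the eigenvalue in [iter_eulers]. *)
Lemma shift_coef (K : fieldType) (charK : [pchar K] =i pred0) (n : nat)
    (I : {set 'I_n}) (f : {mpoly K[n]}) (k : nat) :
  let S := fps (ratfun K n) in
  let fS : {mpoly S[n]} := map_mpoly (fun c => (cstfun n c)%:A) f in
  fps_coef (((\big[comp/idfun]_(i in I) qshift (fps_exp 1) i) fS).@[fun i => (var K i)%:A]) k =
  polyfun (iter k (eulers I) f) / k`!%:R.
Proof.
move=> S fS; rewrite iter_eulers mulr_suml.
have -> : fS = \sum_(m <- msupp f) ((cstfun n f@_m)%:A : S) *: 'X_[m].
  rewrite /fS /map_mpoly /mmap; apply: eq_bigr => m _.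
  by rewrite /= mul_mpolyC mpolyXE_id.
rewrite qshifts_sum raddf_sum fps_coef_sum; apply: eq_bigr => m _.
rewrite qshiftsX /= mevalZ mevalX fps_expX; last exact: pchar_ratfun.
have -> : \prod_(i < n) ((var K i)%:A : S) ^+ m i = (polyfun 'X_[m] : ratfun K n)%:A.
  under eq_bigr do rewrite exprZn expr1n.
  rewrite scaler_prod big1_eq mpolyXE_id rmorph_prod; congr (_ *: _).
  by apply: eq_bigr => i _; rewrite rmorphXn.
rewrite mulr_algl mulr_algr scalerA !fps_coefZ /= mulr1.
by rewrite mulrA [_ * cstfun _ _]mulrC.
Qed.

(** * The integer binomials of the statement as subset counts *)

Lemma binz_draws1 (n r : nat) : (0 < r <= n)%N ->
  binz (n%:Z - 1) (r%:Z - 1) = (draws_over n r 1)%:Z.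
Proof. by case: n r => [|n] [|r]; rewrite // /draws_over /= !subn1. Qed.

Lemma binz_draws2 (n r : nat) : (0 < r <= n)%N ->
  binz (n%:Z - 2) (r%:Z - 2) = (draws_over n r 2)%:Z.
Proof.
by case: n r => [|[|n]] [|[|r]]; rewrite // /draws_over /= !subn2.
Qed.

(** This is Pascal's rule, except at n = r = 1, where the convention that -1 over 0 is 1 is
    needed. *)
Lemma binz_draws12 (n r : nat) : (0 < r <= n)%N ->
  binz (n%:Z - 2) (r%:Z - 1) = (draws_over n r 1)%:Z - (draws_over n r 2)%:Z.
Proof.
case: n r => [|[|n]] [|[|r]] // _; rewrite /draws_over /= !subn1 ?subn2 /= ?bin0 //.
by rewrite binS PoszD addrK.
Qed.

(** * Dunkl operators on symmetric polynomials *)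

Section DunklAction.
Variables (K : fieldType) (n : nat) (beta : K).
Implicit Types (p f : {mpoly K[n]}) (i j : 'I_n).
Local Notation pf := (@polyfun K n).
Local Notation x := (@var K n).
Local Notation b := (cstfun n beta).

Lemma dunkl_polyfun i p : dunkl beta i (pf p) =
  pf (euler i p) + b * \sum_j wt x i j * (pf p - pf (msym (tperm i j) p)).
Proof.
rewrite /dunkl rderiv_polyfun -rmorphM; congr (_ + _ * _).
rewrite [RHS](bigD1 i) //= wtii mul0r add0r.
by apply: eq_bigr => j _; rewrite exch_polyfun.
Qed.

Lemma dunkl_sym i f : f \is symmetric -> dunkl beta i (pf f) = pf (euler i f).
Proof.
move=> /issymP fs; rewrite dunkl_polyfun big1 ?mulr0 ?addr0 // => j _.
by rewrite fs subrr mulr0.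
Qed.

Lemma dunklH1 f : f \is symmetric -> dunklH beta 1 (pf f) = pf (eulers setT f).
Proof.
move=> fs; rewrite /eulers rmorph_sum; apply: eq_big => [i|i _]; rewrite ?inE //.
exact: dunkl_sym.
Qed.

(** The eigenvalues are total degrees, which permutations preserve. This allows [dunklH1] to be
    applied twice. *)
Lemma eulers_sym f : f \is symmetric -> eulers setT f \is symmetric.
Proof.
move=> /issymP fs; apply/issymP => s; apply/mpolyP => m.
rewrite mcoeff_sym !mcoeff_eulers -mcoeff_sym fs; congr (_%:R * _).
by rewrite [RHS](reindex_inj (@perm_inj _ s)) /=; apply: eq_big => i; rewrite ?inE // mnmE.
Qed.

(** The inner Dunkl operator reduces to D_i; in the outer one the exchange of i and j sends D_i f to
    D_j f by symmetry of [f]. *)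
Lemma dunklH2 f : f \is symmetric ->
  dunklH beta 2 (pf f) = \sum_i pf (euler i (euler i f))
    + b * (2 * (\sum_i wtsum x i * pf (euler i f))
           - (n%:R - 1) * \sum_i pf (euler i f)).
Proof.
move=> fs; pose g i := pf (euler i f).
transitivity (\sum_i (pf (euler i (euler i f)) + b * \sum_j wt x i j * (g i - g j))).
  apply: eq_bigr => i _; rewrite /= dunkl_sym // dunkl_polyfun; congr (_ + _ * _).
  by apply: eq_bigr => j _; rewrite msym_euler tpermL (issymP _ fs).
rewrite big_split /= -mulr_sumr; congr (_ + _ * _).
transitivity (\sum_i wtsum x i * g i - \sum_i \sum_j wt x i j * g j).
  rewrite -sumrB; apply: eq_bigr => i _; rewrite mulr_suml -sumrB.
  by apply: eq_bigr => j _; rewrite mulrBr.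
(* Since y_ij + y_ji = 1 off the diagonal, the weights with second index i sum to n - 1 - w_i. *)
have -> : \sum_i \sum_j wt x i j * g j
    = (n%:R - 1) * \sum_i g i - \sum_i wtsum x i * g i.
  rewrite exchange_big mulr_sumr -sumrB; apply: eq_bigr => i _ /=.
  rewrite -mulr_suml -mulrBl; congr (_ * _); apply/(canRL (addrK _)).
  rewrite -big_split /=; under eq_bigr do rewrite (wtD (@var_inj K n)).
  rewrite sumrB sumr_const card_ord (bigD1 i) //= eqxx big1 ?addr0 // => j ji.
  by rewrite (negPf ji).
by ring.
Qed.

End DunklAction.

(** * Elimination of the subset counts *)

(** Here [W] stands for the sum of the w_i, [Z] for the sum in [sum_wt_sqr], [A], [Y], [G] for the
    sums of D_i^2 f, w_i D_i f, D_i f, and [GG] for H_1^2 f. *)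
Lemma second_order_algebra (F : fieldType) (charF : [pchar F] =i pred0)
    (b e1 e2 C n r W Z A Y G GG f c : F) :
    n * e1 = r * C -> (n - 1) * e2 = (r - 1) * e1 ->
    2 * W = n * (n - 1) -> 6 * Z = n * (n - 1) * (2 * n - 1) ->
    2 * c = ((e1 - e2) * A + e2 * GG) + 2 * (b * ((e1 - e2) * Y + e2 * (W * G)))
            + b ^+ 2 * ((e1 - e2) * Z + e2 * W ^+ 2) * f ->
  c = 2^-1 * (e1 - e2) * (A + b * (2 * Y - (n - 1) * G)) + 2^-1 * e2 * GG
      + b * e1 * (r * (n - 1) / 2) * G
      + b ^+ 2 * (r / 24) * C
        * ((3 * r + 1) * n ^+ 2 + (1 - 7 * r) * n + 2 * r) * f.
Proof.
move=> h1 h2 h3 h4 hc.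
have nz k : (k.+1)%:R != 0 :> F by exact: natrS_neq0 charF k.
have [n2 n6 n24] := And3 (nz 1%N) (nz 5%N) (nz 23%N).
have EW : W = n * (n - 1) / 2 by rewrite -h3 mulrAC divff // mul1r.
have EZ : Z = n * (n - 1) * (2 * n - 1) / 6 by rewrite -h4 mulrAC divff // mul1r.
apply: (mulfI n2); rewrite hc; apply/subr0_eq.
(* The multipliers arise by eliminating (n - 1) e2 first and n e1 next. The factor before n e1 - r C
   is the polynomial (3r + 1) n^2 + (1 - 7r) n + 2r of the goal. *)
transitivity (b * G * (n - 1) * ((n - 1) * e2 - (r - 1) * e1)
  + b ^+ 2 / 12 * f * ((2 * (n - 1) * (2 * n - 1)
        + (r - 1) * (3 * n * (n - 1) - 2 * (2 * n - 1))) * (n * e1 - r * C)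
      + (3 * n ^+ 2 * (n - 1) - 2 * n * (2 * n - 1)) * ((n - 1) * e2 - (r - 1) * e1))).
  rewrite EW EZ; have n12 := nz 11%N; have n3 := nz 2%N.
  by field; rewrite ?n2 ?n6 ?n24 ?n12 ?n3.
by rewrite h1 h2 !subrr; ring.
Qed.

(** * The h^2-coefficient of the Macdonald operators *)

Section MacdonaldOrder.
Variables (K : fieldType) (n : nat) (beta : K).
Hypothesis charK : [pchar K] =i pred0.
Implicit Types (f : {mpoly K[n]}) (I : {set 'I_n}).
Local Notation Kx := (ratfun K n).
Local Notation pf := (@polyfun K n).
Local Notation x := (@var K n).
Local Notation b := (cstfun n beta).
Local Notation S := (fps Kx).

Definition mac_weight r I : S :=
  fps_exp b ^+ (r * (r - 1))./2 *
  \prod_(i in I) \prod_(j in ~: I)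
    ((x i - x j)^-1 *: (fps_exp b * (x i)%:A - (x j)%:A)).

(** The factor equals 1 + (t - 1) y_ij. *)
Lemma mac_factor_coef i j k : i != j ->
  fps_coef ((x i - x j)^-1 *: (fps_exp b * (x i)%:A - (x j)%:A)) k =
  if k is 0 then 1 else b ^+ k / k`!%:R * wt x i j.
Proof.
move=> ij; have := subx_neq0 (@var_inj K n) ij => nz.
rewrite fps_coefZ fps_coefB mulr_algr !fps_coefZ fps_coef1 /=.
case: k => [|k]; rewrite /= ?mulr0 ?subr0.
  by rewrite expr0 divr1 !mulr1 mulVf.
by rewrite /wt mulrA [(_ - _)^-1 * _]mulrC [LHS]mulrC.
Qed.

Lemma mac_weight_low r I : #|I| = r ->
  [/\ fps_coef (mac_weight r I) 0 = 1,
      fps_coef (mac_weight r I) 1 = b * \sum_(i in I) wtsum x i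
    & logcoef2 (mac_weight r I) =
        b ^+ 2 * \sum_(i in I) \sum_(j in ~: I) wt x i j * wt x j i].
Proof.
move=> Ir; have charF := pchar_ratfun n charK.
have n2 : (2 : Kx) != 0 by exact: natrS_neq0 charF 1.
have ij i j : i \in I -> j \in ~: I -> i != j.
  by move=> iI; rewrite inE; apply: contraNneq => <-.
pose P i := \prod_(j in ~: I) ((x i - x j)^-1 *: (fps_exp b * (x i)%:A - (x j)%:A)) : S.
have P_low i : i \in I -> [/\ fps_coef (P i) 0 = 1,
    fps_coef (P i) 1 = b * \sum_(j in ~: I) wt x i j
  & logcoef2 (P i) = b ^+ 2 * \sum_(j in ~: I) wt x i j * wt x j i].
  move=> iI; have [|-> -> ->] := fps_prod_low (index_enum 'I_n) (P := mem (~: I))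
    (G := fun j => (x i - x j)^-1 *: (fps_exp b * (x i)%:A - (x j)%:A)).
    by move=> j /(ij _ _ iI) ?; rewrite mac_factor_coef.
  rewrite !mulr_sumr; split=> //; apply: eq_bigr => j /(ij _ _ iI) nij.
    by rewrite mac_factor_coef // divr1.
  (* The factor contributes beta^2 (y_ij - y_ij^2), which [wtM] turns into a product. *)
  rewrite /logcoef2 !mac_factor_coef // wtM; last exact: var_inj.
  rewrite divr1 expr1 (_ : 2`!%N = 2%N) //.
  by move: (wt x i j) (cstfun n beta) => y c; field.
have [|q0 q1 q2] := fps_prod_low (index_enum 'I_n) (P := mem I) (G := P).
  by move=> i /P_low[].
(* The power of t times the double product is treated as a product of two factors indexed by
   booleans. *)
have [] := @fps_prod_low _ bool [:: true; false] xpredT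
  (fun c => if c then fps_exp b ^+ (r * (r - 1))./2 else \prod_(i in I) P i).
  by case; rewrite ?q0 // fps_expX //= expr0 divr1.
rewrite !big_cons !big_nil !mulr1 !addr0 -/(mac_weight r I) q1 q2 fps_expX // => -> -> ->.
split=> //; last first.
  (* The power of t is the exponential of a multiple of h, so its logarithm has no h^2-term. *)
  rewrite {1}/logcoef2 /= mulr_sumr; transitivity (\sum_(i in I) logcoef2 (P i)).
    rewrite divr1 expr1 (_ : 2`!%N = 2%N) //.
    by move: (\sum_(i in I) _) (_ * cstfun n beta) => s c; field.
  by apply: eq_bigr => i /P_low[].
have -> : \sum_(i in I) fps_coef (P i) 1 = b * \sum_(i in I) \sum_(j in ~: I) wt x i j.
  by rewrite mulr_sumr; apply: eq_bigr => i /P_low[].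
have -> : \sum_(i in I) wtsum x i = \sum_(i in I) \sum_(j in I) wt x i j
    + \sum_(i in I) \sum_(j in ~: I) wt x i j.
  rewrite -big_split; apply: eq_bigr => i _; rewrite /wtsum (bigID (mem I)) /=.
  by congr (_ + _); apply: eq_bigl => j; rewrite inE.
(* The exponent r(r-1)/2 of t is exactly the sum of y_ij over i, j in [I]; halving is exact as
   r(r-1) is even. *)
rewrite /= expr1 divr1 mulrDr; congr (_ + _); apply: (mulfI n2).
rewrite [RHS]mulrCA (sum_wt2 (@var_inj K n)) Ir.
rewrite mulrA -natrM mulrC mul2n even_halfK; last first.
  by case: (r) => // k; rewrite subn1 oddM /= andNb.
by case: (r) => [|k]; rewrite ?mul0r // subn1 /= natrM -addn1 natrD addrK.

Qed.

Lemma macdonald_order2 r f :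
  let e1 : Kx := (draws_over n r 1)%:R in
  let e2 : Kx := (draws_over n r 2)%:R in
  2 * macdonald_order beta 2 r f =
  ((e1 - e2) * \sum_i pf (euler i (euler i f)) + e2 * pf (eulers setT (eulers setT f)))
  + 2 * (b * ((e1 - e2) * (\sum_i wtsum x i * pf (euler i f))
               + e2 * ((\sum_i wtsum x i) * \sum_i pf (euler i f))))
  + b ^+ 2 * ((e1 - e2) * (\sum_i wtsum x i ^+ 2 + \sum_i \sum_j wt x i j * wt x j i)
               + e2 * (\sum_i wtsum x i) ^+ 2) * pf f.
Proof.
move=> e1 e2; have n2 : (2 : Kx) != 0 by exact: natrS_neq0 (pchar_ratfun n charK) 1.
pose g i := pf (euler i f).
transitivity (\sum_(I : {set 'I_n} | #|I| == r)
    (pf (eulers I (eulers I f))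
     + 2 * (b * ((\sum_(i in I) wtsum x i) * \sum_(i in I) g i))
     + b ^+ 2 * ((\sum_(i in I) wtsum x i) ^+ 2
         + \sum_(i in I) \sum_(j in ~: I) wt x i j * wt x j i) * pf f)).
  rewrite /macdonald_order /macdonald [X in fps_coef X _]mulr_sumr fps_coef_sum mulr_sumr.
  apply: eq_bigr => I /eqP Ir.
  set v := (meval _ _).
  rewrite [X in fps_coef X _]mulrA -[X in fps_coef X _]/(mac_weight r I * v).
  have Ev k : fps_coef v k = pf (iter k (eulers I) f) / k`!%:R by exact: shift_coef.
  rewrite fps_coefM2 !Ev.
  have [-> E1 E2] := mac_weight_low Ir.
  (* The h^2-coefficient is recovered from [logcoef2] and the square of the h-coefficient. *)
  have E3 : 2 * fps_coef (mac_weight r I) 2 = b ^+ 2 * ((\sum_(i in I) wtsum x i) ^+ 2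
       + \sum_(i in I) \sum_(j in ~: I) wt x i j * wt x j i).
    by rewrite mulrDr -exprMn -E1 -E2 /logcoef2 addrC subrK.
  rewrite -E3 E1; move: (fps_coef (mac_weight r I) 2) => w.
  have -> : pf (iter 1 (eulers I) f) = \sum_(i in I) g i by rewrite /= /eulers rmorph_sum.
  rewrite (_ : 0`!%N = 1%N) // (_ : 1`!%N = 1%N) // (_ : 2`!%N = 2%N) //=.
  move: (pf (eulers _ _)) (pf f) (cstfun n beta) => p2 p0 c.
  move: (\sum_(i in I) wtsum x i) (\sum_(i in I) g i) => s1 s2.
  rewrite !divr1 mul1r. by field.
rewrite !big_split /= -!mulr_suml -!mulr_sumr big_split /=.
congr (_ + _ * (_ * _) + _ * _ * _).
- transitivity (\sum_(I : {set 'I_n} | #|I| == r)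
      \sum_(i in I) \sum_(j in I) pf (euler i (euler j f))).
    apply: eq_bigr => I _; rewrite /eulers rmorph_sum; apply: eq_bigr => i _ /=.
    by rewrite raddf_sum rmorph_sum.
  rewrite sum_draws2 -/e1 -/e2; congr (_ + _ * _).
  rewrite /eulers rmorph_sum; apply: eq_big => [i|i _]; rewrite ?inE //=.
  by rewrite raddf_sum rmorph_sum; apply: eq_big => // j; rewrite inE.
- transitivity (\sum_(I : {set 'I_n} | #|I| == r)
      \sum_(i in I) \sum_(j in I) wtsum x i * g j).
    by apply: eq_bigr => I _; rewrite mulr_suml; apply: eq_bigr => i _; rewrite mulr_sumr.
  rewrite sum_draws2 -/e1 -/e2; congr (_ + _ * _).
  by rewrite mulr_suml; apply: eq_bigr => i _; rewrite mulr_sumr.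
have -> : \sum_(I : {set 'I_n} | #|I| == r) (\sum_(i in I) wtsum x i) ^+ 2 =
    (e1 - e2) * \sum_i wtsum x i ^+ 2 + e2 * (\sum_i wtsum x i) ^+ 2.
  transitivity (\sum_(I : {set 'I_n} | #|I| == r)
      \sum_(i in I) \sum_(j in I) wtsum x i * wtsum x j).
    by apply: eq_bigr => I _; rewrite expr2 mulr_suml; apply: eq_bigr => i _; rewrite mulr_sumr.
  rewrite sum_draws2 -/e1 -/e2; congr (_ + _ * _).
  by rewrite expr2 mulr_suml; apply: eq_bigr => i _; rewrite mulr_sumr.
(* The sum over the complement is the full row minus the part in [I]. The diagonal terms vanish,
   which leaves the single coefficient e1 - e2. *)
have -> : \sum_(I : {set 'I_n} | #|I| == r) \sum_(i in I) \sum_(j in ~: I) wt x i j * wt x j i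
    = (e1 - e2) * \sum_i \sum_j wt x i j * wt x j i.
  transitivity (\sum_(I : {set 'I_n} | #|I| == r)
     (\sum_(i in I) \sum_j wt x i j * wt x j i
      - \sum_(i in I) \sum_(j in I) wt x i j * wt x j i)).
    apply: eq_bigr => I _; rewrite -sumrB; apply: eq_bigr => i _.
    rewrite [in RHS](bigID (mem I)) /= addrAC subrr add0r.
    by apply: eq_bigl => j; rewrite inE.
  rewrite sumrB sum_draws sum_draws2 -/e1 -/e2 [X in _ - (_ * X + _)]big1 => [|i _]; last by rewrite wtii mulr0.
  by rewrite mulr0 add0r mulrBl.
by ring.
Qed.

End MacdonaldOrder.

(** * The second-order formula *)

Theorem proposition4p4 (K : fieldType) (charK : [pchar K] =i pred0)
    (beta : K) (n r : nat) (r_ge1 : (1 <= r)%N) (r_le_n : (r <= n)%N)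
    (f : {mpoly K[n]}) (f_sym : f \is symmetric) :
  let H (k : nat) (u : ratfun K n) : ratfun K n := dunklH beta k u in
  let c (a : K) : ratfun K n := cstfun n a in
  let u : ratfun K n := polyfun f in
  macdonald_order beta 2 r f =
    c (2^-1 * (binz (n%:Z - 2) (r%:Z - 1))%:~R) * H 2%N u
  + c (2^-1 * (binz (n%:Z - 2) (r%:Z - 2))%:~R) * H 1%N (H 1%N u)
  + c (beta * (binz (n%:Z - 1) (r%:Z - 1))%:~R
       * (r%:R * (n%:R - 1) / 2)) * H 1%N u
  + c (beta ^+ 2 * (r%:R / 24) * (binz n%:Z r%:Z)%:~R
       * ((3 * r%:R + 1) * n%:R ^+ 2 + (1 - 7 * r%:R) * n%:R + 2 * r%:R)) * u.
Proof.
move=> H c u; have rn : (0 < r <= n)%N by rewrite r_ge1.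
have charF := pchar_ratfun n charK.
rewrite /H /u !dunklH1 ?eulers_sym // dunklH2 // binz_draws1 // binz_draws2 // binz_draws12 //=.
have -> : polyfun (eulers setT f) = \sum_i polyfun (euler i f).
  by rewrite /eulers rmorph_sum; apply: eq_bigl => i; rewrite inE.
rewrite /c intrB -!pmulrn.
(* Pushing the embedding of constants inwards makes the goal an identity in the field of rational
   functions. *)
rewrite !(rmorph_nat, rmorph1, rmorphXn, fmorphV, rmorphB, rmorphM, rmorphD).
apply: (second_order_algebra charF _ _ (sum_wtsum (@var_inj K n))
  (sum_wt_sqr (@var_inj K n)) (macdonald_order2 beta charK r f)).
  by rewrite -!natrM draws_over1.
have predE k : (0 < k)%N -> k%:R - 1 = k.-1%:R :> ratfun K n.
  by case: k => // k _; rewrite -addn1 natrD addrK addn1.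
by rewrite !predE ?(leq_trans r_ge1) // -!natrM draws_over2.
Qed.
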